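(* Let $M^3_{\mathrm{reg}}\subset\mathbb{R}^6$ be a regular $3$-manifold, $p'\in M^3_{\mathrm{reg}}$, and let $M^3_{\mathrm{sing}}\subset\mathbb{R}^5$ be the projection of $M^3_{\mathrm{reg}}$ along a tangent direction at $p'$, with $p\in M^3_{\mathrm{sing}}$ the image of $p'$. View $M^3_{\mathrm{sing}}$ as the image of $g:\tilde M\to\mathbb{R}^5$, where $\tilde M=M^3_{\mathrm{reg}}$, $g$ is the restriction of the projection and $q=p'$, so that $T_q\tilde M=T_{p'}M^3_{\mathrm{reg}}$. Then $u\in T_{p'}M^3_{\mathrm{reg}}$ is an asymptotic direction of $M^3_{\mathrm{reg}}$ if and only if $u\in T_q\tilde M$ is an asymptotic direction of $M^3_{\mathrm{sing}}$. Moreover, the binormal directions are also the same.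
   Context: Projection: for a non-zero $v\in T_{p'}M^3_{\mathrm{reg}}$, the projection along $v$ is the orthogonal projection of $\mathbb{R}^6$ onto $v^\perp\cong\mathbb{R}^5$; restricted to $M^3_{\mathrm{reg}}$ it has a corank $1$ singularity at $p'$. Under $v^\perp\subset\mathbb{R}^6$ the normal spaces $N_pM^3_{\mathrm{sing}}$ and $N_{p'}M^3_{\mathrm{reg}}$ are the same $3$-dimensional space. Regular case: with $f$ a local parametrisation, $II(v,w)=\pi_2(d^2f(v,w))\in N_{p'}M^3_{\mathrm{reg}}$, $\pi_2$ the orthogonal projection onto the normal space. For a normal vector $\nu$ put $II_\nu(u,w)=\langle II(u,w),\nu\rangle$. A non-zero $u\in T_{p'}M^3_{\mathrm{reg}}$ is asymptotic if there is a non-zero $\nu\in N_{p'}M^3_{\mathrm{reg}}$ with $II_\nu(u,w)=0$ for all $w\in T_{p'}M^3_{\mathrm{reg}}$; such $\nu$ is a binormal direction. Singular case: for $g:\tilde M\to\mathbb{R}^5$ with $g(q)=p$ and $\operatorname{rank}dg_q=2$, put $T_pM=\mathrm{Im}\,dg_q$, $N_pM=(T_pM)^\perp$. In local coordinates, with $f$ the local expression of $g$, $II:T_q\tilde M\times T_q\tilde M\to N_pM$ is the symmetric bilinear map with $II(\partial_{x_i},\partial_{x_j})=\pi_2(f_{x_ix_j})$ at $q$, $\pi_2$ the orthogonal projection onto $N_pM$; $II_\nu(u,w)=\langle II(u,w),\nu\rangle$. A non-zero direction $u\in T_q\tilde M$ is asymptotic if there is a non-zero $\nu\in N_pM$ with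 $II_\nu(u,w)=0$ for all $w\in T_q\tilde M$; such $\nu$ is a binormal direction. *)

(* Defs.v *)
From mathcomp Require Import all_boot all_order all_algebra.
From mathcomp Require Import all_classical all_reals all_analysis.
Set Implicit Arguments.
Unset Strict Implicit.
Unset Printing Implicit Defensive.
Import Order.TTheory GRing.Theory Num.Theory.
Import numFieldNormedType.Exports.
Local Open Scope classical_set_scope.
Local Open Scope ring_scope.

(* Points and vectors of R^n are row vectors, linear maps act on the right, and
   a linear subspace of R^n is the row space of a matrix with n columns. *)

Definition dotv (R : realType) n (u v : 'rV[R]_n) : R := (u *m v^T) 0 0.

Definition orthc (R : realType) m n (A : 'M[R]_(m, n)) : 'M[R]_n := kermx A^T.

Definition orthproj (R : realType) m n (A : 'M[R]_(m, n)) : 'M[R]_n :=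
  proj_mx <<A>>%MS (orthc A).

(* f is of class C^k on U, for U open *)
Fixpoint class_C (R : realType) d n (k : nat) (U : set 'rV[R]_d)
    (f : 'rV[R]_d -> 'rV[R]_n) : Prop :=
  if k is k'.+1 then
    (forall x, U x -> differentiable f x) /\
    (forall a : 'rV[R]_d, class_C k' U ('D_a f))
  else forall x, U x -> {for x, continuous f}.

Definition smooth (R : realType) d n (U : set 'rV[R]_d)
    (f : 'rV[R]_d -> 'rV[R]_n) : Prop := forall k, class_C k U f.

(* phi restricted to U is a smooth immersion and a homeomorphism onto a
   relatively open subset of M (injective, continuous, open as a map into M),
   sending x to p; the values of phi outside U are irrelevant. *)
Definition local_param (R : realType) d n (M : set 'rV[R]_n) (p : 'rV[R]_n)
    (U : set 'rV[R]_d) (phi : 'rV[R]_d -> 'rV[R]_n) (x : 'rV[R]_d) : Prop :=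
  [/\ open U, U x, phi x = p, smooth U phi &
   [/\ forall y, U y -> \rank ('J phi y) = d,
       set_inj U phi &
       forall W : set 'rV[R]_d, open W -> W `<=` U ->
         exists2 V : set 'rV[R]_n, open V & phi @` W = M `&` V]].

Definition regular_manifold (R : realType) (d n : nat) (M : set 'rV[R]_n) : Prop :=
  forall p, M p -> exists (U : set 'rV[R]_d) phi x, local_param M p U phi x.

(* Image of the differential of f at x: the tangent space of a regular manifold
   when f is a local parametrisation, and Im dg_q when f is a local expression
   of a possibly singular map g. *)
Definition tangent (R : realType) d n (f : 'rV[R]_d -> 'rV[R]_n) x : 'M[R]_(d, n) :=
  'J f x.

Definition normal (R : realType) d n (f : 'rV[R]_d -> 'rV[R]_n) x : 'M[R]_n :=
  orthc (tangent f x).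

(* coordinates of a tangent vector w in the basis (d phi_x)(e_i) *)
Definition coords (R : realType) d n (phi : 'rV[R]_d -> 'rV[R]_n) x (w : 'rV[R]_n) :
    'rV[R]_d := w *m pinvmx (tangent phi x).

Definition II_reg (R : realType) d n (phi : 'rV[R]_d -> 'rV[R]_n) x
    (u w : 'rV[R]_n) : 'rV[R]_n :=
  'D_(coords phi x u) ('D_(coords phi x w) phi) x *m orthproj (normal phi x).

Definition partial2 (R : realType) d m (f : 'rV[R]_d -> 'rV[R]_m) (i j : 'I_d) x :
    'rV[R]_m := 'D_(delta_mx 0 i) ('D_(delta_mx 0 j) f) x.

(* Second fundamental form at q = phi x of a map g defined on the manifold
   parametrised by phi.  The local expression of g is g \o phi, and the vectors
   partial_(x_i) of T_q are the (d phi_x)(e_i). *)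
Definition II_sing (R : realType) d n m (g : 'rV[R]_n -> 'rV[R]_m)
    (phi : 'rV[R]_d -> 'rV[R]_n) x (u w : 'rV[R]_n) : 'rV[R]_m :=
  \sum_(i < d) \sum_(j < d) (coords phi x u 0 i * coords phi x w 0 j) *:
    (partial2 (g \o phi) i j x *m orthproj (normal (g \o phi) x)).

Definition reg_binormal_for (R : realType) d n (phi : 'rV[R]_d -> 'rV[R]_n) x
    (u nu : 'rV[R]_n) : Prop :=
  [/\ nu != 0, (nu <= normal phi x)%MS &
      forall w, (w <= tangent phi x)%MS -> dotv (II_reg phi x u w) nu = 0].

Definition sing_binormal_for (R : realType) d n m (g : 'rV[R]_n -> 'rV[R]_m)
    (phi : 'rV[R]_d -> 'rV[R]_n) x (u : 'rV[R]_n) (nu : 'rV[R]_m) : Prop :=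
  [/\ nu != 0, (nu <= normal (g \o phi) x)%MS &
      forall w, (w <= tangent phi x)%MS -> dotv (II_sing g phi x u w) nu = 0].

Definition reg_asymptotic (R : realType) d n (phi : 'rV[R]_d -> 'rV[R]_n) x
    (u : 'rV[R]_n) : Prop :=
  [/\ (u <= tangent phi x)%MS, u != 0 & exists nu, reg_binormal_for phi x u nu].

Definition sing_asymptotic (R : realType) d n m (g : 'rV[R]_n -> 'rV[R]_m)
    (phi : 'rV[R]_d -> 'rV[R]_n) x (u : 'rV[R]_n) : Prop :=
  [/\ (u <= tangent phi x)%MS, u != 0 & exists nu, sing_binormal_for g phi x u nu].

Definition reg_binormal (R : realType) d n (phi : 'rV[R]_d -> 'rV[R]_n) x
    (nu : 'rV[R]_n) : Prop :=
  exists u, [/\ (u <= tangent phi x)%MS, u != 0 & reg_binormal_for phi x u nu].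

Definition sing_binormal (R : realType) d n m (g : 'rV[R]_n -> 'rV[R]_m)
    (phi : 'rV[R]_d -> 'rV[R]_n) x (nu : 'rV[R]_m) : Prop :=
  exists u, [/\ (u <= tangent phi x)%MS, u != 0 & sing_binormal_for g phi x u nu].

(* E encodes an isometry y |-> y *m E from R^m onto v^perp; its inverse on
   v^perp is z |-> z *m E^T. *)
Definition isometry_onto_perp (R : realType) n m (v : 'rV[R]_n) (E : 'M[R]_(m, n)) :
    Prop := E *m E^T = 1%:M /\ (E :=: orthc v)%MS.

(* projection along v: orthogonal projection onto v^perp, followed by the
   identification of v^perp with R^m given by E *)
Definition proj_along (R : realType) n m (v : 'rV[R]_n) (E : 'M[R]_(m, n))
    (z : 'rV[R]_n) : 'rV[R]_m := z *m orthproj (orthc v) *m E^T.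

(* Main.v *)
(** Since [v] is tangent, every normal vector of [M_reg] lies in the perp of
    [v], so it has the form [y E], and [y E] is normal to [M_reg] exactly when
    [y] is normal to the projected map [phi E^T].  Derivatives commute with the
    linear map [E^T], which is adjoint to [E]; hence
    [<II_sing (u, w), y> = <d^2 phi (u, w) E^T, y> = <II_reg (u, w), y E>], and
    [nu = y E] puts the binormals for each [u] in bijection. *)
Require Import Defs.
From mathcomp Require Import all_boot all_order all_algebra.
From mathcomp Require Import all_classical all_reals all_analysis.
Set Implicit Arguments.
Unset Strict Implicit.
Unset Printing Implicit Defensive.
Import Order.TTheory GRing.Theory Num.Theory.
Import numFieldNormedType.Exports.
Local Open Scope classical_set_scope.
Local Open Scope ring_scope.

Lemma sub_orthc (R : realType) k m n (B : 'M[R]_(k, n)) (A : 'M[R]_(m, n)) :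
  (B <= orthc A)%MS = (B *m A^T == 0).
Proof. exact: sub_kermx. Qed.

Lemma dotv_eq0 (R : realType) n (u : 'rV[R]_n) : (dotv u u == 0) = (u == 0).
Proof.
apply/idP/eqP => [|->]; last by rewrite /dotv mul0mx mxE.
rewrite /dotv mxE psumr_eq0 => [/allP u0|i _]; last first.
  by rewrite mxE -expr2 sqr_ge0.
apply/rowP => i; have := u0 i (mem_index_enum i).
by rewrite !mxE mulf_eq0 orbb => /eqP.
Qed.

Lemma dotv_orthc (R : realType) m n (A : 'M[R]_(m, n)) (u w : 'rV[R]_n) :
  (u <= A)%MS -> (w <= orthc A)%MS -> dotv w u = 0.
Proof.
move=> /submxP[a ->]; rewrite sub_orthc => /eqP wA.
by rewrite /dotv trmx_mul mulmxA wA mul0mx mxE.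
Qed.

(** A vector in both spaces is orthogonal to itself, and [dotv] is positive definite over the
    reals. *)
Lemma cap_orthc (R : realType) m n (A : 'M[R]_(m, n)) :
  (A :&: orthc A)%MS = 0.
Proof.
apply/eqP; rewrite -submx0; apply/rV_subP => u; rewrite sub_capmx => /andP[uA uA'].
by rewrite submx0 -dotv_eq0 (dotv_orthc uA uA').
Qed.

(** The intersection is trivial, so the ranks add up to [n]. This makes [orthproj] a genuine
    projection on the whole space, since [proj_mx] behaves as one only on the sum of its two
    subspaces. *)
Lemma add_orthc_full (R : realType) m n (A : 'M[R]_(m, n)) :
  row_full (<<A>> + orthc A)%MS.
Proof.
rewrite /row_full mxrank_disjoint_sum; last first.
  by apply/eqP; rewrite -submx0 -(cap_orthc A) capmxS ?genmxE.
by rewrite genmxE mxrank_ker mxrank_tr subnKC // rank_leq_col.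
Qed.

Lemma orthproj_compl (R : realType) k m n (A : 'M[R]_(m, n)) (W : 'M[R]_(k, n)) :
  (W - W *m orthproj A <= orthc A)%MS.
Proof. exact/proj_mx_compl_sub/submx_full/add_orthc_full. Qed.

(** The part of [w] that the projection discards is orthogonal to [nu]. This lets the projections in
    both second fundamental forms be dropped or inserted when pairing with a normal vector. *)
Lemma dotv_orthproj (R : realType) m n (A : 'M[R]_(m, n)) (w nu : 'rV[R]_n) :
  (nu <= A)%MS -> dotv (w *m orthproj A) nu = dotv w nu.
Proof.
move=> nuA; have := dotv_orthc nuA (orthproj_compl A w).
by rewrite /dotv mulmxBl !mxE => /subr0_eq.
Qed.

Lemma dotv_mulmx_tr (R : realType) m n (w : 'rV[R]_n) (y : 'rV[R]_m)
    (E : 'M[R]_(m, n)) : dotv (w *m E^T) y = dotv w (y *m E).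
Proof. by rewrite /dotv trmx_mul mulmxA. Qed.

(** The rows of [E] span the perp of [v], so [E^T] already kills the component that the orthogonal
    projection removes. *)
Lemma proj_alongE (R : realType) m n (v : 'rV[R]_n) (E : 'M[R]_(m, n)) z :
  isometry_onto_perp v E -> proj_along v E z = z *m E^T.
Proof.
move=> [_ Ev]; have := orthproj_compl (orthc v) z.
have /submxP[c cE] : (E <= orthc v)%MS by rewrite Ev.
rewrite sub_orthc => /eqP zP; apply/esym/eqP; rewrite -subr_eq0 -mulmxBl.
by rewrite cE trmx_mul mulmxA zP mul0mx.
Qed.

Lemma continuous_mulmxr (R : realType) m n (B : 'M[R]_(m, n)) :
  continuous (mulmxr B : 'rV[R]_m -> 'rV[R]_n).
Proof.
move=> z; apply: differentiable_continuous.
(* Coordinates times fixed rows: each term is visibly differentiable. *)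
have -> : (mulmxr B : 'rV[R]_m -> 'rV[R]_n) =
    \sum_(i < m) (fun y : 'rV[R]_m => (y 0 i : R) *: row i B).
  by apply/funext => y; rewrite fct_sumE /= mulmx_sum_row.
by apply: differentiable_sum => i; exact/differentiableZl/differentiable_coord.
Qed.

Lemma diff_mulmxr (R : realType) d m n (f : 'rV[R]_d -> 'rV[R]_m)
    (B : 'M[R]_(m, n)) x : differentiable f x ->
  differentiable (fun y => f y *m B) x /\
  forall a, 'd (fun y => f y *m B) x a = 'd f x a *m B.
Proof.
move=> df; have dB := linear_differentiable (f x) (@continuous_mulmxr R m n B).
split=> [|a]; first exact: (differentiable_comp df dB).
have /(congr1 (@^~ a)) /= := diff_comp df dB.
by rewrite (diff_lin _ (@continuous_mulmxr R m n B)).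
Qed.

Lemma derive_mulmxr (R : realType) d m n (f : 'rV[R]_d -> 'rV[R]_m)
    (B : 'M[R]_(m, n)) x a : differentiable f x ->
  'D_a (fun y => f y *m B) x = 'D_a f x *m B.
Proof.
move=> df; have [dfB dfBE] := diff_mulmxr B df.
by rewrite !deriveE // dfBE.
Qed.

Lemma tangent_mulmxr (R : realType) d m n (f : 'rV[R]_d -> 'rV[R]_m)
    (B : 'M[R]_(m, n)) x : differentiable f x ->
  tangent (fun y => f y *m B) x = tangent f x *m B.
Proof.
move=> df; have [dfB dfBE] := diff_mulmxr B df.
(* Row [i] of a Jacobian is the directional derivative along the [i]-th basis vector. *)
apply/row_matrixP => i; rewrite row_mul !rowE /tangent -!deriveEjacobian //.
exact: derive_mulmxr.
Qed.

Lemma derive_sum_delta (R : realType) d n (f : 'rV[R]_d -> 'rV[R]_n) a x :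
  differentiable f x ->
  'D_a f x = \sum_(i < d) a 0 i *: 'D_(delta_mx 0 i) f x.
Proof.
move=> df; rewrite deriveE // {1}(row_sum_delta a) linear_sum.
by apply: eq_bigr => i _; rewrite linearZ deriveE.
Qed.

Lemma eq_in_open_derive (R : realType) d n (U : set 'rV[R]_d)
    (f g : 'rV[R]_d -> 'rV[R]_n) a x : open U -> U x ->
  (forall y, U y -> f y = g y) -> 'D_a f x = 'D_a g x.
Proof.
move=> oU Ux fg; apply: near_eq_derive.
by apply: filterS (open_nbhs_nbhs (conj oU Ux)).
Qed.

Section SecondDerivative.
Variables (R : realType) (d n : nat) (U : set 'rV[R]_d).
Variables (f : 'rV[R]_d -> 'rV[R]_n) (x : 'rV[R]_d).
Hypotheses (oU : open U) (Ux : U x) (fC2 : class_C 2 U f).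

Let df y : U y -> differentiable f y. Proof. exact: fC2.1. Qed.
Let ddf a : differentiable ('D_a f) x. Proof. exact: (fC2.2 a).1. Qed.

(** Reconciles the two encodings of the second differential: [II_reg] iterates directional
    derivatives, [II_sing] sums second partials. *)
Lemma derive2_partial2 a b :
  'D_a ('D_b f) x =
  \sum_(i < d) \sum_(j < d) (a 0 i * b 0 j) *: partial2 f i j x.
Proof.
rewrite derive_sum_delta //; apply: eq_bigr => i _.
(* The inner expansion is available only on [U], where [f] is differentiable; as [U] is open,
   agreement there suffices for the derivative at [x]. *)
rewrite (@eq_in_open_derive _ _ _ U _
    (\sum_(j < d) b 0 j *: 'D_(delta_mx 0 j) f)) //; last first.
  move=> y Uy; rewrite derive_sum_delta; last exact: df.
  by rewrite fct_sumE.
rewrite derive_sum => [|j]; last exact/derivableZ/diff_derivable.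
rewrite scaler_sumr; apply: eq_bigr => j _.
by rewrite deriveZ ?scalerA //; exact: diff_derivable.
Qed.

Lemma partial2_mulmxr m (B : 'M[R]_(n, m)) i j :
  partial2 (fun y => f y *m B) i j x = partial2 f i j x *m B.
Proof.
rewrite /partial2 -derive_mulmxr //; apply: (@eq_in_open_derive _ _ _ U) => // y Uy.
exact/derive_mulmxr/df.
Qed.

End SecondDerivative.

Section Projection.
Variables (R : realType) (d m n : nat) (U : set 'rV[R]_d).
Variables (phi : 'rV[R]_d -> 'rV[R]_n) (x : 'rV[R]_d).
Variables (v : 'rV[R]_n) (E : 'M[R]_(m, n)).
Hypotheses (oU : open U) (Ux : U x) (phiC2 : class_C 2 U phi).
Hypotheses (vT : (v <= tangent phi x)%MS) (vE : isometry_onto_perp v E).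

Let g := proj_along v E.

Let gphiE : g \o phi = fun y => phi y *m E^T.
Proof. by apply/funext => y /=; exact: proj_alongE. Qed.

(** With [T] the tangent matrix of [phi], that of [g \o phi] is [T E^T], and
    [y (T E^T)^T = (y E) T^T]. *)
Lemma sub_normal_proj (y : 'rV[R]_m) :
  (y <= normal (g \o phi) x)%MS = (y *m E <= normal phi x)%MS.
Proof.
rewrite !sub_orthc gphiE tangent_mulmxr; last exact: phiC2.1.
by rewrite trmx_mul trmxK mulmxA.
Qed.

Lemma normal_lift (nu : 'rV[R]_n) :
  (nu <= normal phi x)%MS -> exists y : 'rV[R]_m, nu = y *m E.
Proof.
rewrite sub_orthc => /eqP nuT; apply/submxP; rewrite vE.2 sub_orthc.
by case/submxP: vT => c ->; rewrite trmx_mul mulmxA nuT mul0mx.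
Qed.

Lemma dotv_II_proj (u w : 'rV[R]_n) (y : 'rV[R]_m) :
  (y *m E <= normal phi x)%MS ->
  dotv (II_sing g phi x u w) y = dotv (II_reg phi x u w) (y *m E).
Proof.
move=> yE; rewrite dotv_orthproj // -dotv_mulmx_tr (derive2_partial2 oU) //.
(* As [y] is normal to the image, its normal projection can be inserted on the right, after which
   the two double sums agree term by term. *)
rewrite -sub_normal_proj in yE; rewrite -[RHS](dotv_orthproj _ yE) !mulmx_suml.
congr (dotv _ _); apply: eq_bigr => i _; rewrite !mulmx_suml; apply: eq_bigr => j _.
by rewrite -!scalemxAl gphiE (partial2_mulmxr oU).
Qed.

Lemma sing_binormal_forE (u : 'rV[R]_n) (y : 'rV[R]_m) :
  sing_binormal_for g phi x u y <-> reg_binormal_for phi x u (y *m E).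
Proof.
(* Right multiplication by [E] is injective because [E *m E^T = 1]. *)
have y0 : (y *m E != 0) = (y != 0).
  congr negb; apply/eqP/eqP => [yE0|->]; last by rewrite mul0mx.
  by rewrite -[y]mulmx1 -vE.1 mulmxA yE0 mul0mx.
split=> -[nz yN II0]; split.
- by rewrite y0.
- by rewrite -sub_normal_proj.
- by move=> w wT; rewrite -dotv_II_proj -?sub_normal_proj // II0.
- by rewrite -y0.
- by rewrite sub_normal_proj.
- by move=> w wT; rewrite dotv_II_proj // II0.
Qed.

Lemma reg_binormal_forE (u nu : 'rV[R]_n) : reg_binormal_for phi x u nu <->
  exists2 y : 'rV[R]_m, sing_binormal_for g phi x u y & nu = y *m E.
Proof.
split=> [nuB|[y yB ->]]; last exact/sing_binormal_forE.
have [_ /normal_lift[y nuE] _] := nuB.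
by exists y => //; apply/sing_binormal_forE; rewrite -nuE.
Qed.

End Projection.

Theorem theorem5p4 (R : realType) (M : set 'rV[R]_6) (p' : 'rV[R]_6)
    (hM : regular_manifold 3 M) (hp' : M p')
    (U : set 'rV[R]_3) (phi : 'rV[R]_3 -> 'rV[R]_6) (x : 'rV[R]_3)
    (hphi : local_param M p' U phi x)
    (v : 'rV[R]_6) (hv : (v <= tangent phi x)%MS) (hv0 : v != 0)
    (E : 'M[R]_(5, 6)) (hE : isometry_onto_perp v E) :
  let g := proj_along v E in
  (forall u : 'rV[R]_6, (u <= tangent phi x)%MS ->
     (reg_asymptotic phi x u <-> sing_asymptotic g phi x u)) /\
  (forall u : 'rV[R]_6, (u <= tangent phi x)%MS -> u != 0 ->
     forall nu : 'rV[R]_6, reg_binormal_for phi x u nu <->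
       exists2 y : 'rV[R]_5, sing_binormal_for g phi x u y & nu = y *m E) /\
  (forall nu : 'rV[R]_6, reg_binormal phi x nu <->
     exists2 y : 'rV[R]_5, sing_binormal g phi x y & nu = y *m E).
Proof.
case: hphi => oU Ux _ phiC _ g.
(* All three claims follow from this correspondence at a fixed [u], by quantifying over [u] or over
   the normal vector. *)
have binE u nu := reg_binormal_forE oU Ux (phiC 2) hv hE u nu.
split; [|split] => [u uT|u uT u0 nu|nu]; last 2 first.
- exact: binE.
- split=> [[u [uT u0 /binE[y yB nuE]]]|[y [u [uT u0 yB]] nuE]].
    by exists y => //; exists u.
  by exists u; split=> //; apply/binE; exists y.
split=> -[_ u0 [nu nuB]]; split=> //.
  by have [y yB _] := (binE u nu).1 nuB; exists y.
by exists (nu *m E); apply/binE; exists nu.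
Qed.
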